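(* Let $k\ge 3$ be an integer. Then the smallest $\chi$-binding function for $\mathcal{B}_k$ is $\Omega_k(x^{\lfloor k/2\rfloor})$ if $k\ge 4$, and is $\Omega(x^2)$ if $k=3$.
   Context: All graphs are finite and simple. An equivalence graph is a graph each of whose connected components is complete. For graphs $H_1,\dots,H_k$ on a common vertex set $V$, $H_1\oplus\cdots\oplus H_k$ is the graph on $V$ in which distinct $a,b$ are adjacent iff they are adjacent in an odd number of the $H_i$. $\mathcal{B}_k$ is the class of all graphs $H_1\oplus\cdots\oplus H_k$ with each $H_i$ an equivalence graph on a common vertex set (the $k$-XOR of the class of equivalence graphs). For a $\chi$-bounded class $\mathcal{X}$, its smallest $\chi$-binding function is $f^*(m)=\max\{\chi(G): G\in\mathcal{X},\ \omega(G)=m\}$, where $\chi$ is the chromatic number and $\omega$ the clique number. The subscript $k$ in $\Omega_k$ indicates the hidden constant depends on $k$. *)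

(* Defs.v *)
From mathcomp Require Import all_boot.

Set Implicit Arguments.
Unset Strict Implicit.
Unset Printing Implicit Defensive.

Record graph (V : finType) := Graph {
  adj :> rel V;
  adj_sym : symmetric adj;
  adj_irr : irreflexive adj
}.

Definition proper_coloring (V : finType) (G : graph V) (n : nat)
    (c : {ffun V -> 'I_n}) : bool :=
  [forall x, forall y, adj G x y ==> (c x != c y)].

Definition colorable (V : finType) (G : graph V) (n : nat) : bool :=
  [exists c : {ffun V -> 'I_n}, proper_coloring G c].

Lemma colorable_card (V : finType) (G : graph V) : exists n, colorable G n.
Proof.
exists #|V|; apply/existsP; exists [ffun x => enum_rank x].
apply/forallP => x; apply/forallP => y; apply/implyP => xy.
rewrite !ffunE; apply: contraTneq xy => /enum_rank_inj ->.
by rewrite adj_irr.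
Qed.

Definition chromatic_number (V : finType) (G : graph V) : nat :=
  ex_minn (colorable_card G).

Definition clique (V : finType) (G : graph V) (A : {set V}) : bool :=
  [forall x in A, forall y in A, (x != y) ==> adj G x y].

Definition clique_number (V : finType) (G : graph V) : nat :=
  \max_(A : {set V} | clique G A) #|A|.

Definition equivalence_graph (V : finType) (G : graph V) : Prop :=
  forall x y, connect (adj G) x y -> x != y -> adj G x y.

Definition xor_adj (V : finType) (k : nat) (H : 'I_k -> graph V) : rel V :=
  fun a b => odd #|[set i | adj (H i) a b]|.

Lemma xor_adj_sym (V : finType) (k : nat) (H : 'I_k -> graph V) :
  symmetric (xor_adj H).
Proof.
move=> a b; rewrite /xor_adj; congr (odd #|pred_of_set _|).
by apply/setP => i; rewrite !inE adj_sym.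
Qed.

Lemma xor_adj_irr (V : finType) (k : nat) (H : 'I_k -> graph V) :
  irreflexive (xor_adj H).
Proof.
move=> a; rewrite /xor_adj (_ : [set i | _] = set0) ?cards0 //.
by apply/setP => i; rewrite !inE adj_irr.
Qed.

Definition xor_graph (V : finType) (k : nat) (H : 'I_k -> graph V) : graph V :=
  Graph (xor_adj_sym H) (xor_adj_irr H).

Definition graph_class := forall V : finType, graph V -> Prop.

Definition B (k : nat) : graph_class := fun V G =>
  exists H : 'I_k -> graph V,
    (forall i, equivalence_graph (H i)) /\ adj G =2 adj (xor_graph H).

Definition is_maximum (S : nat -> Prop) (n : nat) : Prop :=
  S n /\ forall c, S c -> c <= n.

(* As [f] is a total function into [nat], this entails that [X] is chi-bounded
   (and that [X] has graphs of every clique number); such an [f] is unique. *)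
Definition is_smallest_chi_binding (X : graph_class) (f : nat -> nat) : Prop :=
  forall m, is_maximum
    (fun c => exists (V : finType) (G : graph V),
       [/\ X V G, clique_number G = m & chromatic_number G = c]) (f m).

(* Main.v *)
(* Upper bound.  If [x] and [y] are adjacent, the set of the [H i] having them
   in one component has odd cardinality, so it suffices to properly colour, for
   each odd [S], the pairs for which this set is exactly [S], and to take the
   product of the colourings.  Such pairs behave like the disjoint pairs of edges
   of a [k]-partite hypergraph, whose cover number is at most [k] times its
   matching number.

   Lower bound.  Take all of [q]^k, two points being adjacent when they agree in
   an odd number of coordinates.  For even [k = 2j], an independent set is a code
   with only [j] nontrivial agreement numbers, so it has [O(q^j)] elements by
   Delsarte's bound, whereas a clique has [O(q)] elements by the oddtown argument
   over F_2; hence the chromatic number is of order at least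
   [q^(2j) / q^j = q^j].  For [k = 3] the roles of the two fields are exchanged:
   independent sets have size [O(q)] over F_2, and cliques have size [O(q)] over
   the rationals, since any two of their points agree exactly once.  A disjoint
   union with a complete graph adjusts the clique number. *)
Require Import Defs.
From mathcomp Require Import all_boot all_order all_algebra.
Import GRing.Theory Num.Theory.

Set Implicit Arguments.
Unset Strict Implicit.
Unset Printing Implicit Defensive.

(** * Cliques, colourings and equivalence graphs *)

Section GraphBasics.
Variables (V : finType) (G : graph V).

Lemma clique_card (A : {set V}) : clique G A -> #|A| <= clique_number G.
Proof. exact: (@leq_bigmax_cond _ (clique G) (fun A : {set V} => #|A|) A). Qed.

Lemma clique_number_leq (m : nat) :
  (forall A : {set V}, clique G A -> #|A| <= m) -> clique_number G <= m.
Proof. by move=> Gm; apply/bigmax_leqP. Qed.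

Lemma cliqueP (A : {set V}) :
  reflect {in A &, forall x y, x != y -> adj G x y} (clique G A).
Proof.
apply: (iffP forall_inP) => [GA x y Ax Ay | GA x Ax].
  by move/forall_inP: (GA x Ax) => /(_ y Ay)/implyP.
by apply/forall_inP => y Ay; apply/implyP; apply: GA.
Qed.

Lemma chromatic_colorable : colorable G (chromatic_number G).
Proof. by rewrite /chromatic_number; case: ex_minnP. Qed.

Lemma chromatic_leq (T : finType) (c : V -> T) :
  (forall x y, adj G x y -> c x != c y) -> chromatic_number G <= #|T|.
Proof.
move=> c_proper; rewrite /chromatic_number; case: ex_minnP => n _; apply.
apply/existsP; exists [ffun x => enum_rank (c x)].
apply/forallP => x; apply/forallP => y; apply/implyP => xy; rewrite !ffunE.
by apply: contraNneq (c_proper _ _ xy) => /enum_rank_inj->.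
Qed.

(** The classes of an optimal colouring are independent and partition [V]. *)
Lemma card_leq_chromatic (a : nat) :
    (forall A : {set V}, {in A &, forall x y, ~~ adj G x y} -> #|A| <= a) ->
  #|V| <= chromatic_number G * a.
Proof.
move=> indep_leq; have /existsP[c /forallP c_proper] := chromatic_colorable.
rewrite -sum1_card (partition_big c xpredT) //=.
rewrite -[X in X * a]card_ord -sum_nat_const; apply: leq_sum => i _.
rewrite sum1_card -cardsE; apply: indep_leq => x y.
rewrite !inE => /eqP cx /eqP cy; apply/negP => xy.
by have /forallP/(_ y)/implyP/(_ xy) := c_proper x; rewrite -val_eqE /= cx cy eqxx.
Qed.

End GraphBasics.

Lemma chromatic_hom (V W : finType) (G : graph V) (G' : graph W) (h : V -> W) :
  (forall x y, adj G x y -> adj G' (h x) (h y)) ->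
  chromatic_number G <= chromatic_number G'.
Proof.
move=> h_hom; have /existsP[c /forallP c_proper] := chromatic_colorable G'.
rewrite -[leqRHS]card_ord; apply: (chromatic_leq (c := c \o h)) => x y xy.
by move/forallP: (c_proper (h x)) => /(_ (h y))/implyP; apply; apply: h_hom.
Qed.

Lemma equivalence_graphP (V : finType) (G : graph V) :
  equivalence_graph G <->
  (forall y x z, adj G x y -> adj G y z -> x != z -> adj G x z).
Proof.
split=> [Geq y x z xy yz | Gtrans x y /connectP[p]].
  by apply: Geq; apply: connect_trans (connect1 xy) (connect1 yz).
elim: p x => [|z p IHp] x /= => [_ -> /eqP // | /andP[xz zp] y_last xy].
have [<- // | zy] := eqVneq z y.
by apply: Gtrans xz _ xy; apply: IHp.
Qed.

Lemma odd_card_pred0 (T : finType) (P : pred T) :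
  P =1 xpred0 -> odd #|[set i | P i]| = false.
Proof. by move=> P0; rewrite (eq_finset _ P0) cards0. Qed.

(** * Codes with few agreement numbers *)

Section Agreement.
Local Open Scope ring_scope.

Definition agreement (k q : nat) (x y : {ffun 'I_k -> 'I_q}) : nat :=
  #|[set i | x i == y i]|.

Lemma agreementxx (k q : nat) (x : {ffun 'I_k -> 'I_q}) : agreement x x = k.
Proof.
rewrite /agreement -[RHS]card_ord -cardsT.
by congr #|pred_of_set _|; apply/setP => i; rewrite !inE eqxx.
Qed.

Lemma agreement_lt (k q : nat) (x y : {ffun 'I_k -> 'I_q}) :
  x != y -> (agreement x y < k)%N.
Proof.
move=> xy; rewrite -[ltnRHS]card_ord -cardsT; apply: proper_card.
rewrite properT; apply: contraNneq xy => agr_T; apply/eqP/ffunP => i; apply/eqP.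
by have := in_setT i; rewrite -agr_T inE.
Qed.

(* The Delsarte bound on codes with few distances: the matrix of the products
   [\prod_l (agreement x y - L_l)] over [x, y] in [A] is diagonal and
   invertible, but is an entrywise product of [size L] matrices of rank at
   most [k * q + 1]. *)
Lemma few_agreements_bound (F : fieldType) (k q : nat)
    (A : {set {ffun 'I_k -> 'I_q}}) (L : seq F) :
    k%:R \notin L ->
    {in A &, forall x y, x != y -> (agreement x y)%:R \in L} ->
  (#|A| <= (k * q + 1) ^ size L)%N.
Proof.
(* One coordinate per pair (position, symbol) makes the inner product count agreements; the extra
   [unit] coordinate subtracts [c]. *)
move=> kL AL; pose T := ('I_k * 'I_q + unit)%type.
pose u (c : F) (x : {ffun 'I_k -> 'I_q}) (t : T) : F :=
  if t is inl iv then (x iv.1 == iv.2)%:R else - c.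
pose w (y : {ffun 'I_k -> 'I_q}) (t : T) : F :=
  if t is inl iv then (y iv.1 == iv.2)%:R else 1.
have uwE c x y : \sum_t u c x t * w y t = (agreement x y)%:R - c.
  rewrite big_sumType /= (big_pred1 tt) => [|[]] //=; rewrite mulr1; congr (_ - c).
  rewrite -(pair_bigA _ (fun i v => (x i == v)%:R * (y i == v)%:R)) /=.
  rewrite /agreement -sum1dep_card natr_sum [RHS]big_mkcond; apply: eq_bigr => i _.
  rewrite (bigD1 (x i)) //= eqxx mul1r big1 ?addr0 1?eq_sym => [|v].
    by case: eqP.
  by rewrite eq_sym => /negbTE->; rewrite mul0r.
pose M : 'M[F]_#|A| := \matrix_(a, b)
  \prod_(l < size L) ((agreement (enum_val a) (enum_val b))%:R - L`_l).
have M_unit : M \in unitmx.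
  have -> : M = diag_mx (\row_(a < #|A|) \prod_(l < size L) (k%:R - L`_l)).
    apply/matrixP => a b; rewrite !mxE.
    have [<- | ab] := eqVneq a b; first by rewrite agreementxx mulr1n.
    have /(nthP 0)[l ltl Ll] : (agreement (enum_val a) (enum_val b))%:R \in L.
      by apply: AL; rewrite ?enum_valP // (inj_eq enum_val_inj).
    by rewrite (bigD1 (Ordinal ltl)) //= Ll subrr mul0r mulr0n.
  rewrite unitmxE det_diag unitfE; apply/prodf_neq0 => a _; rewrite mxE.
  apply/prodf_neq0 => l _; rewrite subr_eq0; apply: contraNneq kL => ->.
  exact: mem_nth.
(* Expanding the product of [size L] sums picks one coordinate in [T] per factor, so [M] factors
   through dimension [#|D|]. *)
pose D := {ffun 'I_(size L) -> T}.
have -> : ((k * q + 1) ^ size L = #|D|)%N.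
  by rewrite card_ffun card_sum card_prod !card_ord card_unit.
rewrite -(mxrank_unit M_unit).
suff -> : M = (\matrix_(a < #|A|, g < #|D|)
                 \prod_(l < size L) u L`_l (enum_val a) ((enum_val g : D) l))
          *m (\matrix_(g < #|D|, b < #|A|)
                 \prod_(l < size L) w (enum_val b) ((enum_val g : D) l)).
  exact: mulmx_max_rank.
apply/matrixP => a b; rewrite !mxE.
under eq_bigr do rewrite -uwE.
rewrite (bigA_distr_bigA (fun (l : 'I_(size L)) t =>
  u L`_l (enum_val a) t * w (enum_val b) t)).
rewrite (reindex _ (onW_bij _ (@enum_val_bij D))) /=.
by apply: eq_bigr => g _; rewrite !mxE big_split.
Qed.

End Agreement.

(** Over the rationals: the even numbers below [j + j] take only [j] values, none equal to
    [j + j]. *)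
Lemma even_grid_independent (j q : nat) (A : {set {ffun 'I_(j + j) -> 'I_q}}) :
  {in A &, forall x y, x != y -> ~~ odd (agreement x y)} ->
  #|A| <= ((j + j) * q + 1) ^ j.
Proof.
move=> Aeven; pose L : seq rat := [seq (i.*2)%:R%R | i <- iota 0 j].
have := @few_agreements_bound rat (j + j) q A L; rewrite size_map size_iota.
apply=> [|x y Ax Ay xy].
  apply/mapP => -[i]; rewrite mem_iota add0n addnn => /andP[_ ltij] /eqP.
  by rewrite eqr_nat -!muln2 eqn_pmul2r // => /eqP ji; rewrite ji ltnn in ltij.
have /negbTE odd0 := Aeven x y Ax Ay xy; have agr_lt := agreement_lt xy.
have agrE : agreement x y = (agreement x y)./2.*2.
  by rewrite -{1}(odd_double_half (agreement x y)) odd0.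
rewrite agrE; apply/mapP; exists (agreement x y)./2 => //.
by rewrite mem_iota /= add0n -ltn_double -agrE -addnn.
Qed.

Lemma natr_F2 (n : nat) : n%:R%R = (odd n)%:R%R :> 'F_2.
Proof.
rewrite -{1}(odd_double_half n) natrD -muln2 natrM.
by rewrite (_ : 2%:R%R = 0%R :> 'F_2) ?mulr0 ?addr0 //; apply: val_inj.
Qed.

(** In ['F_2] every odd agreement is 1 while the self-agreement [j + j] is 0, so one value
    suffices. *)
Lemma even_grid_clique (j q : nat) (A : {set {ffun 'I_(j + j) -> 'I_q}}) :
  {in A &, forall x y, x != y -> odd (agreement x y)} ->
  #|A| <= (j + j) * q + 1.
Proof.
move=> Aodd; rewrite -[leqRHS]expn1.
apply: (@few_agreements_bound 'F_2 _ _ A [:: 1%R]) => [|x y Ax Ay xy].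
  by rewrite inE natr_F2 addnn odd_double.
by rewrite inE natr_F2 Aodd.
Qed.

(** In ['F_2] the self-agreement 3 is 1 and every even agreement is 0. *)
Lemma cube_independent (q : nat) (A : {set {ffun 'I_3 -> 'I_q}}) :
  {in A &, forall x y, x != y -> ~~ odd (agreement x y)} ->
  #|A| <= (3 * q + 1) ^ 1.
Proof.
move=> Aeven.
apply: (@few_agreements_bound 'F_2 _ _ A [:: 0%R]) => [|x y Ax Ay xy] //.
by rewrite inE natr_F2 (negbTE (Aeven _ _ _ _ _)).
Qed.

(** An odd number below 3 is 1, which differs from 3 in the rationals though not in ['F_2]. *)
Lemma cube_clique (q : nat) (A : {set {ffun 'I_3 -> 'I_q}}) :
  {in A &, forall x y, x != y -> odd (agreement x y)} ->
  #|A| <= 3 * q + 1.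
Proof.
move=> Aodd; rewrite -[leqRHS]expn1.
apply: (@few_agreements_bound rat _ _ A [:: 1%R]) => [|x y Ax Ay xy] //.
rewrite inE; have := agreement_lt xy; have := Aodd x y Ax Ay xy.
by case: (agreement x y) => [|[|[|n]]].
Qed.

(** * Label graphs, disjoint unions and padding *)

Section GraphConstructions.

(** The components are the fibres of [l]: constant [l] gives a complete graph, injective [l] an
    edgeless one. *)
Definition label_adj (V : finType) (T : eqType) (l : V -> T) : rel V :=
  fun x y => (x != y) && (l x == l y).

Lemma label_adj_sym (V : finType) (T : eqType) (l : V -> T) :
  symmetric (label_adj l).
Proof. by move=> x y; rewrite /label_adj eq_sym (eq_sym (l x)). Qed.

Lemma label_adj_irr (V : finType) (T : eqType) (l : V -> T) :
  irreflexive (label_adj l).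
Proof. by move=> x; rewrite /label_adj eqxx. Qed.

Definition label_graph (V : finType) (T : eqType) (l : V -> T) : graph V :=
  Graph (label_adj_sym l) (label_adj_irr l).

Lemma label_graph_equivalence (V : finType) (T : eqType) (l : V -> T) :
  equivalence_graph (label_graph l).
Proof.
apply/equivalence_graphP => y x z /andP[_ /eqP xy] /andP[_ /eqP yz] xz.
by rewrite /= /label_adj xz xy yz /=.
Qed.

Variables (V W : finType).

Definition sum_adj (G : graph V) (G' : graph W) : rel (V + W) :=
  fun u v => match u, v with
             | inl x, inl y => adj G x y
             | inr x, inr y => adj G' x y
             | _, _ => false
             end.

Lemma sum_adj_sym (G : graph V) (G' : graph W) : symmetric (sum_adj G G').
Proof. by move=> [x|x] [y|y] //=; apply: adj_sym. Qed.

Lemma sum_adj_irr (G : graph V) (G' : graph W) : irreflexive (sum_adj G G').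
Proof. by move=> [x|x] /=; apply: adj_irr. Qed.

Definition sum_graph (G : graph V) (G' : graph W) : graph (V + W)%type :=
  Graph (sum_adj_sym G G') (sum_adj_irr G G').

Lemma sum_graph_equivalence (G : graph V) (G' : graph W) :
  equivalence_graph G -> equivalence_graph G' ->
  equivalence_graph (sum_graph G G').
Proof.
move=> /equivalence_graphP G_eq /equivalence_graphP G'_eq.
apply/equivalence_graphP => -[y|y] [x|x] [z|z] //=.
  exact: G_eq.
exact: G'_eq.
Qed.

Lemma clique_number_sum (G : graph V) (G' : graph W) :
  clique_number (sum_graph G G') = maxn (clique_number G) (clique_number G').
Proof.
apply/eqP; rewrite eqn_leq geq_max; apply/and3P; split.
- apply: clique_number_leq => A /cliqueP A_clique; rewrite leq_max.
  pose A1 := [set x | inl x \in A]; pose A2 := [set x | inr x \in A].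
  have A1_clique : clique G A1.
    by apply/cliqueP => x y; rewrite !inE => Ax Ay xy; apply: A_clique Ax Ay _.
  have A2_clique : clique G' A2.
    by apply/cliqueP => x y; rewrite !inE => Ax Ay xy; apply: A_clique Ax Ay _.
  have [A1_0|[x Ax]] := set_0Vmem A1; apply/orP; [right|left]; last first.
    apply: leq_trans (clique_card A1_clique).
    rewrite -(card_imset _ (@inl_inj V W)); apply: subset_leq_card.
    apply/subsetP => -[y Ay|y Ay]; first by rewrite imset_f ?inE.
    by rewrite inE in Ax; have := A_clique _ _ Ax Ay isT.
  apply: leq_trans (clique_card A2_clique).
  rewrite -(card_imset _ (@inr_inj V W)); apply: subset_leq_card.
  apply/subsetP => -[y Ay|y Ay]; last by rewrite imset_f ?inE.
  by have := in_set0 y; rewrite -A1_0 inE Ay.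
- apply: clique_number_leq => A /cliqueP A_clique.
  rewrite -(card_imset _ (@inl_inj V W)); apply: clique_card.
  apply/cliqueP => _ _ /imsetP[x Ax ->] /imsetP[y Ay ->] xy.
  by apply: A_clique.
apply: clique_number_leq => A /cliqueP A_clique.
rewrite -(card_imset _ (@inr_inj V W)); apply: clique_card.
apply/cliqueP => _ _ /imsetP[x Ax ->] /imsetP[y Ay ->] xy.
by apply: A_clique.
Qed.

Lemma B_sum (k : nat) (G : graph V) (G' : graph W) :
  B k G -> B k G' -> B k (sum_graph G G').
Proof.
move=> [H [H_eq GH]] [H' [H'_eq GH']].
exists (fun i => sum_graph (H i) (H' i)); split=> [i|].
  exact: sum_graph_equivalence.
by move=> [x|x] [y|y]; rewrite /= ?GH ?GH' // /xor_adj /= odd_card_pred0.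
Qed.

End GraphConstructions.

(** The [d] additional summands are edgeless, so no parity changes. *)
Lemma B_addn (k d : nat) (V : finType) (G : graph V) : B k G -> B (k + d) G.
Proof.
move=> [H [H_eq GH]].
exists (fun i => if split i is inl i' then H i' else label_graph id).
split=> [i|x y]; first by case: split => // _; apply: label_graph_equivalence.
rewrite GH /= /xor_adj -!sum1dep_card [in RHS]big_mkcond /= big_split_ord /=.
rewrite [X in _ + X]big1 ?addn0 => [|i _]; last first.
  rewrite -[rshift k i]/(unsplit (inr i)) unsplitK /= /label_adj.
  by case: eqP.
rewrite big_mkcond; congr odd; apply: eq_bigr => i _.
by rewrite -[lshift d i]/(unsplit (inl i)) unsplitK.
Qed.

Lemma B_complete (k : nat) (V : finType) :
  0 < k -> B k (label_graph (fun _ : V => tt)).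
Proof.
move=> k0; rewrite -(subnKC k0); apply: B_addn.
exists (fun=> label_graph (fun=> tt)); split=> [_|x y].
  exact: label_graph_equivalence.
by rewrite /= /xor_adj -sum1dep_card big_mkcond big_ord1 /=; case: label_adj.
Qed.

Lemma clique_number_complete (V : finType) :
  clique_number (label_graph (fun _ : V => tt)) = #|V|.
Proof.
apply/eqP; rewrite eqn_leq; apply/andP; split.
  by apply: clique_number_leq => A _; apply: max_card.
rewrite -cardsT; apply: clique_card; apply/cliqueP => x y _ _ xy.
by rewrite /= /label_adj xy eqxx.
Qed.

(** The binding function at [m] needs clique number exactly [m], whereas the grids only come with an
    upper bound. *)
Lemma B_pad_clique_number (k m : nat) (V : finType) (G : graph V) :
    0 < k -> B k G -> clique_number G <= m ->
  exists (W : finType) (G' : graph W),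
    [/\ B k G', clique_number G' = m & chromatic_number G <= chromatic_number G'].
Proof.
move=> k0 GB Gm.
exists (V + 'I_m)%type, (sum_graph G (label_graph (fun _ : 'I_m => tt))); split.
- by apply: B_sum => //; apply: B_complete.
- by rewrite clique_number_sum clique_number_complete card_ord; apply/maxn_idPr.
by apply: (@chromatic_hom _ _ _ _ inl).
Qed.

(** * Grid graphs and the lower bound *)

Definition grid_graph (k q : nat) : graph {ffun 'I_k -> 'I_q} :=
  xor_graph (fun i => label_graph (fun x : {ffun 'I_k -> 'I_q} => x i)).

Lemma grid_adjE (k q : nat) (x y : {ffun 'I_k -> 'I_q}) :
  adj (grid_graph k q) x y = (x != y) && odd (agreement x y).
Proof.
rewrite /= /xor_adj /agreement; have [-> | xy] := eqVneq x y => /=.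
  by rewrite odd_card_pred0 // => i; rewrite /label_adj eqxx.
by congr (odd #|pred_of_set _|); apply/setP => i; rewrite !inE /= /label_adj xy.
Qed.

Lemma grid_B (k q : nat) : B k (grid_graph k q).
Proof.
exists (fun i => label_graph (fun x : {ffun 'I_k -> 'I_q} => x i)).
by split=> // i; apply: label_graph_equivalence.
Qed.

Lemma grid_lower_bound (k' k s t : nat) :
    0 < k' <= k -> k' = s + t ->
    (forall q (A : {set {ffun 'I_k' -> 'I_q}}),
       {in A &, forall x y, x != y -> odd (agreement x y)} ->
       #|A| <= k' * q + 1) ->
    (forall q (A : {set {ffun 'I_k' -> 'I_q}}),
       {in A &, forall x y, x != y -> ~~ odd (agreement x y)} ->
       #|A| <= (k' * q + 1) ^ t) ->
  forall m, k' < m -> exists (V : finType) (G : graph V),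
    [/\ B k G, clique_number G = m &
        m ^ s <= (2 * k') ^ k' * chromatic_number G].
Proof.
move=> /andP[k'0 k'k] k'E cliques indeps m ltk'm.
(* The largest [q] with [k' * q + 1 <= m], so that the clique bound fits under [m]; it is positive
   as [k' < m]. *)
pose q := m.-1 %/ k'.
have m0 : 0 < m := leq_ltn_trans (leq0n k') ltk'm.
have q0 : 0 < q by rewrite divn_gt0 // -ltnS prednK.
have m_lt : m <= k' * q + k'.
  have := ltn_ceil m.-1 k'0; rewrite prednK // -/q mulSn.
  by rewrite [q * k']mulnC addnC.
have m_ge : k' * q + 1 <= m.
  by rewrite addn1 mulnC; apply: leq_ltn_trans (leq_divM _ _) _; rewrite prednK.
have grid_m : clique_number (grid_graph k' q) <= m.
  apply: leq_trans m_ge; apply: clique_number_leq => A /cliqueP A_clique.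
  apply: cliques => x y Ax Ay xy.
  by have := A_clique x y Ax Ay xy; rewrite grid_adjE xy.
have grid_chi : q ^ k' <= chromatic_number (grid_graph k' q) * (k' * q + 1) ^ t.
  have -> : q ^ k' = #|{ffun 'I_k' -> 'I_q}| by rewrite card_ffun !card_ord.
  apply: card_leq_chromatic => A A_indep; apply: indeps => x y Ax Ay xy.
  by have := A_indep x y Ax Ay; rewrite grid_adjE xy.
have gridB : B k (grid_graph k' q).
  by rewrite -(subnKC k'k); apply/B_addn/grid_B.
have [W [G' [G'B G'm chi]]] :=
  B_pad_clique_number (leq_trans k'0 k'k) gridB grid_m.
exists W, G'; split=> //.
have m_leq : m <= 2 * k' * q.
  apply: leq_trans m_lt _; rewrite -mulnA mul2n -addnn leq_add2l.
  by rewrite leq_pmulr.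
have q_leq : k' * q + 1 <= 2 * k' * q := leq_trans m_ge m_leq.
(* Cancel [q ^ t] from [q ^ k'], after bounding [k' * q + 1] by [2 * k' * q]. *)
have kq_chi : q ^ s <= (2 * k') ^ t * chromatic_number G'.
  rewrite -(@leq_pmul2r (q ^ t)) ?expn_gt0 ?q0 // -expnD -k'E.
  apply: leq_trans grid_chi _; rewrite mulnAC -expnMn [leqRHS]mulnC.
  by apply: leq_mul => //; case: (t) => // t'; rewrite leq_exp2r.
apply: (@leq_trans ((2 * k' * q) ^ s)).
  by case: (s) => // s'; rewrite leq_exp2r.
by rewrite [X in _ ^ X * _]k'E expnD expnMn -mulnA leq_mul.
Qed.

(** * Chi-boundedness of XORs of equivalence graphs *)

Section ChiBounded.
Variables (V : finType) (k : nat) (H : 'I_k -> graph V).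
Hypothesis H_eq : forall i, equivalence_graph (H i).

Definition same_block (i : 'I_k) (x y : V) : bool := (x == y) || adj (H i) x y.

Lemma same_block_refl i x : same_block i x x.
Proof. by rewrite /same_block eqxx. Qed.

Lemma same_block_sym i x y : same_block i x y = same_block i y x.
Proof. by rewrite /same_block eq_sym adj_sym. Qed.

Lemma same_block_trans i y x z :
  same_block i x y -> same_block i y z -> same_block i x z.
Proof.
rewrite /same_block => /predU1P[-> // | xy] /predU1P[<- | yz].
  by rewrite xy orbT.
have [//|/= xz] := eqVneq x z.
by have /equivalence_graphP := @H_eq i; apply; [apply: xy | apply: yz |].
Qed.

Definition block_set (x y : V) : {set 'I_k} := [set i | same_block i x y].

Lemma xor_adjE x y : xor_adj H x y = (x != y) && odd #|block_set x y|.
Proof.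
have [-> | xy] := eqVneq x y; first exact: xor_adj_irr.
rewrite /xor_adj; congr (odd #|pred_of_set _|).
by apply/setP => i; rewrite !inE /same_block (negbTE xy).
Qed.

(* Inside a class of [S \subset block_set x y], the pairs with block set
   exactly [S] are the disjoint pairs of a multipartite hypergraph: each vertex
   lies in a maximal matching [M] or shares a block outside [S] with an element
   of [M], and vertices sharing a block outside [S] may get the same colour. *)
Lemma color_block_set (m : nat) (S : {set 'I_k}) :
    odd #|S| -> clique_number (xor_graph H) <= m ->
  exists c : V -> 'I_m.+1 * option 'I_k,
    forall x y, x != y -> block_set x y = S -> c x != c y.
Proof.
move=> S_odd Hm.
pose matching (M : {set V}) := [forall x in M, forall y in M,
  (x != y) && (S \subset block_set x y) ==> (block_set x y == S)].
have [M M_max] : {M | maxset matching M}.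
  by apply: ex_maxset; exists set0; apply/forall_inP => x; rewrite inE.
have M_matching x y : x \in M -> y \in M -> x != y ->
    S \subset block_set x y -> block_set x y = S.
  move=> Mx My xy xyS; have /forall_inP/(_ x Mx) := maxsetp M_max.
  by move=> /forall_inP/(_ y My); rewrite xy xyS => /eqP.
have block_sub x y : S \subset block_set x y ->
    forall i, i \in S -> same_block i x y.
  by move=> /subsetP xyS i /xyS; rewrite inE.
have block_trans y x z : S \subset block_set x y -> S \subset block_set y z ->
    S \subset block_set x z.
  move=> xyS yzS; apply/subsetP => i Si; rewrite inE.
  by apply: (same_block_trans (y := y)); apply: block_sub Si.
have block_sym x y : block_set x y = block_set y x.
  by apply/setP => i; rewrite !inE same_block_sym.
(* The members of [M] in the [S]-class of [x]. Two of them share exactly the blocks in [S], an odd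
   number, so they are adjacent and [C x] is a clique. *)
pose C x := [set z in M | S \subset block_set x z].
have C_card x : #|C x| <= m.
  apply: leq_trans Hm; apply: clique_card; apply/cliqueP => y z.
  rewrite !inE => /andP[My xyS] /andP[Mz xzS] yz.
  rewrite /= xor_adjE yz M_matching //.
  by apply: block_trans xzS; rewrite block_sym.
(* A witness for [x]: either [x] itself, or a member of [C x] together with an index outside [S] of
   a block shared with [x]. *)
pose good x (p : V * option 'I_k) := (p.1 \in C x) &&
  (if p.2 is Some i then (i \notin S) && same_block i x p.1 else p.1 == x).
have good_ex x : exists p, good x p.
  have [Mx | Mx] := boolP (x \in M).
    exists (x, None); rewrite /good inE Mx eqxx andbT.
    by apply/subsetP => i _; rewrite inE same_block_refl.
  have [/existsP // | /existsPn none] := boolP [exists p, good x p].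
  (* Without a witness, [x] could be added to [M], against maximality. *)
  have Mx_matching : matching (x |: M).
    have x_far y : y \in M -> S \subset block_set x y -> block_set x y = S.
      move=> My xyS; apply/eqP; rewrite eqEsubset xyS andbT.
      apply/subsetP => i; rewrite inE => xyi; apply: contraT => Si.
      by have := none (y, Some i); rewrite /good /= inE My xyS Si xyi.
    apply/forall_inP => y My; apply/forall_inP => z Mz.
    apply/implyP => /andP[yz yzS]; apply/eqP; move: My Mz yz yzS.
    move=> /setU1P[-> | My] /setU1P[-> | Mz] yz yzS.
    - by rewrite eqxx in yz.
    - exact: x_far.
    - by rewrite block_sym x_far // block_sym.
    exact: M_matching.
  have MxM := maxsetsup M_max Mx_matching (subsetUr _ _).
  by rewrite -MxM setU11 in Mx.
pose p x := xchoose (good_ex x).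
(* The colour records the position of the witness in [C x] and the index of the shared block. *)
exists (fun x => (inord (index (p x).1 (enum (C x))), (p x).2)) => x y xy xyS.
apply/eqP => -[/(congr1 val) /=].
have /andP[Cx px] := xchooseP (good_ex x).
have /andP[Cy py] := xchooseP (good_ex y).
rewrite -/(p x) -/(p y) in Cx px Cy py.
(* Both vertices lie in one [S]-class, so equal positions mean the same witness; a block outside [S]
   shared with it would then be shared by [x] and [y], contradicting [block_set x y = S]. *)
have CE : C x = C y.
  apply/setP => z; rewrite !inE; congr (_ && _).
  apply/idP/idP; apply: block_trans; last by rewrite xyS.
  by rewrite block_sym xyS.
have index_lt z u : index u (enum (C z)) < m.+1.
  by apply: leq_trans (C_card z); rewrite cardE; apply: index_size.
rewrite !inordK ?index_lt // CE => index_eq.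
have p1E : (p x).1 = (p y).1.
  rewrite CE in Cx; rewrite -(@nth_index _ x (p x).1 (enum (C y))) ?mem_enum //.
  by rewrite index_eq nth_index ?mem_enum.
rewrite -p1E in py; move: px py => + + p2E; rewrite -p2E.
case: (p x).2 => [i /andP[Si xi] /andP[_ yi] | /eqP px /eqP py].
  case/negP: Si; rewrite -xyS inE; apply: same_block_trans xi _.
  by rewrite same_block_sym.
by rewrite -px py eqxx in xy.
Qed.

Lemma chromatic_xor_bound (m : nat) : clique_number (xor_graph H) <= m ->
  chromatic_number (xor_graph H) <= #|{ffun {set 'I_k} -> 'I_m.+1 * option 'I_k}|.
Proof.
move=> Hm.
have colors (S : {set 'I_k}) :
    exists c : {ffun V -> 'I_m.+1 * option 'I_k}, [forall x, forall y,
    [&& odd #|S|, x != y & block_set x y == S] ==> (c x != c y)].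
  have [S_odd | S_even] := boolP (odd #|S|); last first.
    (* Even [S] never arise from adjacent vertices, so a constant colouring will do. *)
    by exists [ffun=> (ord0, None)]; apply/forallP => x; apply/forallP.
  have [c c_proper] := color_block_set S_odd Hm; exists (finfun c).
  apply/forallP => x; apply/forallP => y; rewrite !ffunE.
  by apply/implyP => /and3P[_ xy /eqP]; apply: c_proper.
pose c S := xchoose (colors S).
apply: (chromatic_leq (c := fun x => [ffun S => c S x])) => x y.
rewrite /= xor_adjE => /andP[xy xy_odd]; apply/eqP => /ffunP/(_ (block_set x y)).
rewrite !ffunE => cE.
have /forallP/(_ x)/forallP/(_ y) := xchooseP (colors (block_set x y)).
by rewrite -/(c _) xy_odd xy eqxx cE eqxx.
Qed.

End ChiBounded.

Lemma eq_adj_clique_number (V : finType) (G G' : graph V) :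
  adj G =2 adj G' -> clique_number G = clique_number G'.
Proof.
move=> GG'; apply: eq_bigl => A.
by apply/cliqueP/cliqueP => A_clique x y Ax Ay xy; have := A_clique x y Ax Ay xy;
  rewrite GG'.
Qed.

Lemma B_chi_bounded (k : nat) (V : finType) (G : graph V) : B k G ->
  chromatic_number G <=
    #|{ffun {set 'I_k} -> 'I_(clique_number G).+1 * option 'I_k}|.
Proof.
move=> [H [H_eq GH]].
apply: leq_trans (chromatic_xor_bound H_eq (m := clique_number G) _).
  by apply: (@chromatic_hom _ _ _ _ id) => x y; rewrite GH.
by rewrite (eq_adj_clique_number GH).
Qed.

(* The binding function and its asymptotics *)
From mathcomp Require Import all_classical reals topology normedtype landau.
Import numFieldNormedType.Exports.
Local Open Scope ring_scope.
Local Open Scope classical_set_scope.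

Lemma bounded_has_maximum (S : nat -> Prop) (b : nat) :
    (exists n, S n) -> (forall n, S n -> (n <= b)%N) ->
  exists n, is_maximum S n.
Proof.
move=> [n0 Sn0] Sb.
have ex : exists n, `[< S n >] by exists n0; apply/asboolP.
have ub n : `[< S n >] -> (n <= b)%N by move=> /asboolP/Sb.
have [n /asboolP Sn n_max] := ex_maxnP ex ub.
by exists n; split=> // c Sc; apply: n_max; apply/asboolP.
Qed.

(** The chromatic numbers at clique number [m] are bounded, and the complete graph on [m] vertices
    supplies one, so a maximum exists. *)
Lemma B_smallest_chi_binding (k : nat) :
  (0 < k)%N -> exists f, is_smallest_chi_binding (B k) f.
Proof.
move=> k0; suff /choice[f f_max] : forall m, exists n, is_maximum
    (fun c => exists (V : finType) (G : graph V),
       [/\ B k G, clique_number G = m & chromatic_number G = c]) n by exists f.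
move=> m.
apply: (@bounded_has_maximum _ #|{ffun {set 'I_k} -> 'I_m.+1 * option 'I_k}|).
  pose K := label_graph (fun _ : 'I_m => tt); exists (chromatic_number K), 'I_m, K.
  by split=> //; [apply: B_complete | rewrite clique_number_complete card_ord].
by move=> _ [V [G [GB <- <-]]]; apply: B_chi_bounded.
Qed.

Lemma bigOmega_natr_expn (R : realType) (f : nat -> nat) (s c N : nat) :
    (forall m, (N < m)%N -> (m ^ s <= c * f m)%N) ->
  (fun x : nat => (f x)%:R : R^o) \is 'Omega_\oo (fun x : nat => x%:R ^+ s : R^o).
Proof.
(* Using [c.+1] keeps the constant positive and invertible even when [c] is 0. *)
move=> f_ge; apply/asboolP; exists (c.+1%:R^-1); first by rewrite invr_gt0 ltr0n.
exists N.+1 => // m /= ltNm.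
rewrite ger0_norm ?exprn_ge0 // ger0_norm // ler_pdivrMl ?ltr0n //.
rewrite -natrX -natrM ler_nat; apply: leq_trans (f_ge m ltNm) _.
by rewrite leq_mul2r leqnSn orbT.
Qed.

Theorem theorem5p19 (R : realType) (k : nat) (hk : (3 <= k)%N) :
  exists f : nat -> nat,
    is_smallest_chi_binding (B k) f /\
    ((4 <= k)%N ->
       (fun x : nat => (f x)%:R : R^o) \is 'Omega_\oo
         (fun x : nat => x%:R ^+ (k %/ 2)%N : R^o)) /\
    (k = 3%N ->
       (fun x : nat => (f x)%:R : R^o) \is 'Omega_\oo
         (fun x : nat => x%:R ^+ 2 : R^o)).
Proof.
have [f f_binding] := @B_smallest_chi_binding k (ltnW (ltnW hk)).
have f_Omega k' s t : (0 < k' <= k)%N -> k' = (s + t)%N ->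
    (forall q (A : {set {ffun 'I_k' -> 'I_q}}),
       {in A &, forall x y, x != y -> odd (agreement x y)} ->
       (#|A| <= k' * q + 1)%N) ->
    (forall q (A : {set {ffun 'I_k' -> 'I_q}}),
       {in A &, forall x y, x != y -> ~~ odd (agreement x y)} ->
       (#|A| <= (k' * q + 1) ^ t)%N) ->
    (fun x : nat => (f x)%:R : R^o) \is 'Omega_\oo
      (fun x : nat => x%:R ^+ s : R^o).
  move=> k'_bounds k'E cliques indeps.
  apply: (@bigOmega_natr_expn R f s ((2 * k') ^ k') k') => m ltk'm.
  have [V [G [GB Gm chi]]] := grid_lower_bound k'_bounds k'E cliques indeps ltk'm.
  apply: leq_trans chi _; rewrite leq_mul2l; apply/orP; right.
  by apply: (f_binding m).2; exists V, G.
exists f; split=> //; split=> [k_ge4 | k3].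
  (* Round [k] down to an even [k']; for odd [k] the last summand is edgeless. *)
  apply: (@f_Omega (k %/ 2 + k %/ 2)%N _ (k %/ 2)%N) => //.
  - rewrite addn_gt0 divn_gt0 // (ltnW (ltnW k_ge4)) /= addnn -muln2.
    exact: leq_divM.
  - exact: even_grid_clique.
  exact: even_grid_independent.
apply: (@f_Omega 3%N 2%N 1%N) => // q A; first exact: cube_clique.
exact: cube_independent.
Qed.
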